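(* Let $(\vec x,\vec y)$ be a Fibonacci positive specialization, $n\ge1$, and let $\boldsymbol\sigma\in\mathfrak S_n$ be a random involution distributed according to $\nu_n(\cdot\mid\varphi_{\vec x,\vec y},\varphi_{\mathrm{PL}})$. Then, with $\tau$ an auxiliary parameter, $$\mathbb E_{\nu_n}\bigl[\tau^{\#\,\text{two-cycles}(\boldsymbol\sigma)}\bigr]=(x_1\cdots x_n)^{-1}\det E_n,$$ where $E_n$ is the $n\times n$ quadridiagonal matrix with $(k,k)$ entry $x_k$, $(k,k+1)$ entry $(1-k\tau)\,y_k$, $(k,k+2)$ entry $-k\tau\,x_ky_{k+1}$, $(k+1,k)$ entry $1$, and all other entries $0$.
   Context: A Fibonacci word is a finite (possibly empty) word in the letters $1,2$; $|w|$ is the sum of its letters; $\mathbb{YF}_n$ is the set of words of weight $n$. For sequences $\vec x,\vec y$: $A_\ell$ ($A_0=1$) is the determinant of the $\ell\times\ell$ tridiagonal matrix with diagonal $x_1,\ldots,x_\ell$, superdiagonal $y_1,\ldots,y_{\ell-1}$ and subdiagonal entries $1$; $B_k(m)$ is the determinant of the $(k+1)\times(k+1)$ tridiagonal matrix with diagonal $y_{m+1},x_{m+3},\ldots,x_{m+k+2}$, superdiagonal $x_{m+1}y_{m+2},y_{m+3},\ldots,y_{m+k+1}$, subdiagonal entries $1$. Clone Schur functions: $s_{1^k}=A_k$, $s_{1^k2u}=B_k(|u|)\,s_u$. $(\vec x,\vec y)$ is Fibonacci positive if $s_w(\vec x\mid\vec y)>0$ for all $w$. The clone harmonic function is $\varphi_{\vec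 x,\vec y}(w)=s_w(\vec x\mid\vec y)/(x_1\cdots x_{|w|})$. Young–Fibonacci Robinson–Schensted shape: for a permutation $\boldsymbol\sigma=(\boldsymbol\sigma_1,\ldots,\boldsymbol\sigma_n)$ in one-line notation, process the entries from right to left; each not yet matched entry $\boldsymbol\sigma_k$ is matched with the maximal unmatched entry among those in positions $\le k$ (possibly with itself). Record a letter $1$ if $\boldsymbol\sigma_k$ is matched with itself and a letter $2$ otherwise; the recorded letters, written left to right in the order produced, form the shape $w(\boldsymbol\sigma)\in\mathbb{YF}_n$. For an involution, the letters $2$ and $1$ of $w(\boldsymbol\sigma)$ correspond to its two-cycles and fixed points, and the number of involutions with shape $w$ is $\dim(w)$, where $\dim(\varnothing)=1$, $\dim(1v)=\dim(v)$, $\dim(2v)=(|v|+1)\dim(v)$. The measure $\nu_n(\cdot\mid\varphi_{\vec x,\vec y},\varphi_{\mathrm{PL}})$ on involutions in $\mathfrak S_n$: choose a shape $w\in\mathbb{YF}_n$ with probability $\dim(w)\varphi_{\vec x,\vec y}(w)$, and then an involution uniformly among the $\dim(w)$ involutions of shape $w$ (the uniform choice being the one given by the cotransition probabilities of the Plancherel harmonic function $\varphi_{\mathrm{PL}}(w)=\dim(w)/|w|!$). Equivalently $\nu_n(\boldsymbol\sigma)=\varphi_{\vec x,\vec y}(w(\boldsymbol\sigma))$. *)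

(* Defs.v *)
From mathcomp Require Import all_boot all_order all_algebra all_fingroup.

Set Implicit Arguments.
Unset Strict Implicit.
Unset Printing Implicit Defensive.

Import GRing.Theory Num.Theory.

Local Open Scope ring_scope.

(* A letter is a bool, so that the letter [a] has numerical value [a.+1]. *)
Notation fibword := (seq bool).
Notation L1 := false (only parsing).
Notation L2 := true (only parsing).

Definition weight (w : fibword) : nat := (\sum_(a <- w) (a : nat).+1)%N.

Fixpoint yfdim (w : fibword) : nat :=
  match w with
  | [::] => 1%N
  | L1 :: v => yfdim v
  | L2 :: v => ((weight v).+1 * yfdim v)%N
  end.

(* The sequences (x_k), (y_k), k >= 1, are functions on nat whose value at 0
   is never used. Matrix indices start at 0. *)
Section CloneSchur.
Variable R : realFieldType.
Implicit Types (x y : nat -> R) (w : fibword).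

Definition tridiag (l : nat) (d u : nat -> R) : 'M[R]_l :=
  \matrix_(i < l, j < l)
    if j == i :> nat then d i
    else if j == i.+1 :> nat then u i
    else if i == j.+1 :> nat then 1
    else 0.

Definition cloneA x y (l : nat) : R :=
  \det (tridiag l (fun i => x i.+1) (fun i => y i.+1)).

Definition cloneB x y (k m : nat) : R :=
  \det (tridiag k.+1
          (fun i => if i == 0%N then y m.+1 else x (m + i + 2)%N)
          (fun i => if i == 0%N then x m.+1 * y m.+2 else y (m + i + 2)%N)).

(* [k] counts the letters 1 read since the last letter 2. *)
Fixpoint clone_schur_rec x y (k : nat) w : R :=
  match w with
  | [::] => cloneA x y k
  | L1 :: v => clone_schur_rec x y k.+1 v
  | L2 :: u => cloneB x y k (weight u) * clone_schur_rec x y 0 u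
  end.

Definition clone_schur x y w : R := clone_schur_rec x y 0 w.

Lemma clone_schur_ones x y k : clone_schur x y (nseq k L1) = cloneA x y k.
Proof.
rewrite /clone_schur -[in RHS](addn0 k); move: 0%N.
by elim: k => [|k IH] j //=; rewrite IH addnS.
Qed.

Lemma clone_schur_ones_two x y k u :
  clone_schur x y (nseq k L1 ++ L2 :: u)
  = cloneB x y k (weight u) * clone_schur x y u.
Proof.
suff H j : clone_schur_rec x y j (nseq k L1 ++ L2 :: u)
           = cloneB x y (k + j) (weight u) * clone_schur_rec x y 0 u by rewrite /clone_schur H addn0.
by elim: k j => [|k IH] j //=; rewrite IH addnS.
Qed.

Definition fibonacci_positive x y : Prop := forall w, 0 < clone_schur x y w.

Definition clone_harmonic x y w : R :=
  clone_schur x y w / \prod_(1 <= i < (weight w).+1) x i.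

End CloneSchur.

(* [s] is a permutation in one-line notation, [M] lists the entries already
   matched, and the positions [k-1, ..., 0] of [s] remain to be processed. *)
Fixpoint yf_shape_rec (s : seq nat) (k : nat) (M : seq nat) : fibword :=
  if k is k'.+1 then
    let a := nth 0%N s k' in
    if a \in M then yf_shape_rec s k' M
    else
      let m := (\max_(b <- take k s | b \notin M) b)%N in
      if m == a then L1 :: yf_shape_rec s k' (a :: M)
      else L2 :: yf_shape_rec s k' (a :: m :: M)
  else [::].

(* Entries are numbered from 0, which does not affect comparisons. *)
Definition one_line (n : nat) (s : 'S_n) : seq nat :=
  [seq (s i : nat) | i <- enum 'I_n].

Definition yf_shape (n : nat) (s : 'S_n) : fibword :=
  yf_shape_rec (one_line s) n [::].

Definition involutions (n : nat) : {set 'S_n} :=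
  [set s : 'S_n | (s * s == 1)%g].

Definition two_cycles (n : nat) (s : 'S_n) : nat :=
  #|[set C in porbits s | #|C| == 2%N]|.

Section Nu.
Variable R : realFieldType.
Implicit Types x y : nat -> R.

(* Probability of the shape, times the uniform probability among the
   involutions of that shape. *)
Definition nu x y (n : nat) (s : 'S_n) : R :=
  if s \in involutions n then
    let w := yf_shape s in
    (yfdim w)%:R * clone_harmonic x y w
    * (#|[set t in involutions n | yf_shape t == w]|%:R)^-1
  else 0.

Definition expectation (T : finType) (P X : T -> R) : R :=
  \sum_(t : T) P t * X t.

Definition quadridiagE x y (tau : R) (n : nat) : 'M[R]_n :=
  \matrix_(i < n, j < n)
    let k := i.+1 in
    if j == i :> nat then x k
    else if j == i.+1 :> nat then (1 - k%:R * tau) * y k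
    else if j == i.+2 :> nat then - (k%:R * tau * x k * y k.+1)
    else if i == j.+1 :> nat then 1
    else 0.

End Nu.

(* Main.v *)
(* The letters 2 of the shape of an involution are its two-cycles, and every
   word of weight n is the shape of some involution of S_n, so summing first
   over the involutions of a given shape w turns the expectation into
   D_n / (x_1 ... x_n), where D_n is the sum of dim(w) tau^#2(w) s_w over the
   words w of weight n. Splitting w as 1^n or 1^k 2 u gives
     D_n = A_n + sum_m (m + 1) tau B_{n-2-m}(m) D_m,
   and the three-term recurrences of A and B turn this into
     D_n = x_n D_{n-1} - (1 - (n-1) tau) y_{n-1} D_{n-2}
           - (n-2) tau x_{n-2} y_{n-1} D_{n-3},
   which is the expansion of det E_n along its last column. *)
Require Import Defs.
From mathcomp Require Import all_boot all_order all_algebra all_fingroup.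
From mathcomp Require Import zify ring.

Set Implicit Arguments.
Unset Strict Implicit.
Unset Printing Implicit Defensive.

Import GRing.Theory.

Local Open Scope ring_scope.

(** * Determinants of Hessenberg matrices with unit subdiagonal *)

Section Hessenberg.
Variables (R : comNzRingType) (M : nat -> nat -> R).

Definition leading_det (n : nat) : R := \det (\matrix_(i < n, j < n) M i j).

(** The last column is kept free so that expansion along the last row stays within the same family
    of determinants. *)
Definition last_col_det (n : nat) (c : nat -> R) : R :=
  \det (\matrix_(i < n.+1, j < n.+1) if j == n :> nat then c i else M i j).

Lemma leading_detS n : leading_det n.+1 = last_col_det n (M^~ n).
Proof. by congr (\det _); apply/matrixP=> i j; rewrite !mxE; case: eqP => // ->. Qed.

Lemma leading_det0 : leading_det 0 = 1.
Proof. exact: det_mx00. Qed.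

Lemma last_col_det_0 c : last_col_det 0 c = c 0%N.
Proof. by rewrite /last_col_det det_mx11 mxE. Qed.

Lemma last_col_det_zero n (c : nat -> R) :
  (forall i, (i <= n)%N -> c i = 0) -> last_col_det n c = 0.
Proof.
move=> c0; rewrite /last_col_det (expand_det_col _ ord_max) big1 // => i _.
by rewrite mxE eqxx c0 ?mul0r // -ltnS.
Qed.

Hypothesis subdiag1 : forall i, M i.+1 i = 1.
Hypothesis below0 : forall i j, (j.+1 < i)%N -> M i j = 0.

(** The last row has at most two nonzero entries, 1 and [c n.+1]. Striking out the column of the 1
    leaves [c] as last column, so the second minor is again a [last_col_det]. *)
Lemma last_col_detS n c :
  last_col_det n.+1 c = c n.+1 * leading_det n.+1 - last_col_det n c.
Proof.
rewrite {1}/last_col_det (expand_det_row _ ord_max) !big_ord_recr /=.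
rewrite big1 ?add0r => [|i _]; last first.
  rewrite mxE /= below0 ?ltnS // ifN ?mul0r //.
  by rewrite neq_ltn (ltn_trans (ltn_ord i)).
rewrite !mxE /= eqxx ifN ?neq_ltn ?ltnSn // subdiag1 mul1r addrC /cofactor /=.
rewrite addnn -mul2n exprM sqrrN !expr1n mul1r.
rewrite addSn addnn -mul2n exprS exprM sqrrN !expr1n mulr1 mulN1r.
congr (_ * _ - _); congr (\det _); apply/matrixP=> i j; rewrite !mxE /= /bump.
  by rewrite !(leqNgt n.+1) !ltn_ord !add0n ifN // neq_ltn ltn_ord.
rewrite (leqNgt n.+1) ltn_ord add0n; case: (ltngtP j n) => [jn|jn|jn].
- by rewrite add0n ifN // neq_ltn ltnS ltnW.
- by have := ltn_ord j; rewrite ltnS leqNgt jn.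
- by rewrite jn add1n eqxx.
Qed.

Hypothesis above0 : forall i j, (i.+2 < j)%N -> M i j = 0.

Lemma leading_det1 : leading_det 1 = M 0 0.
Proof. by rewrite leading_detS last_col_det_0. Qed.

Lemma leading_det2 : leading_det 2 = M 1 1 * M 0 0 - M 0 1.
Proof. by rewrite leading_detS last_col_detS last_col_det_0 leading_det1. Qed.

Lemma leading_det_quadridiag n :
  leading_det n.+3 = M n.+2 n.+2 * leading_det n.+2
    - M n.+1 n.+2 * leading_det n.+1 + M n n.+2 * leading_det n.
Proof.
(* Two peelings of the last row leave a last column in which only the bottom entry lies within the
   band. *)
suff low: last_col_det n (M^~ n.+2) = M n n.+2 * leading_det n.
  by rewrite leading_detS !last_col_detS low; ring.
case: n => [|n]; first by rewrite last_col_det_0 leading_det0 mulr1.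
rewrite last_col_detS (@last_col_det_zero n) ?subr0 // => i le_in.
by rewrite above0.
Qed.

End Hessenberg.

(** * Weighted sums of clone Schur functions and their recurrences *)

Section CloneSchurSums.
Variables (R : realFieldType) (x y : nat -> R) (tau : R).

(** One array indexed by all of [nat], whose leading blocks are the tridiagonal matrices of every
    size. *)
Definition tridiag_entry (d u : nat -> R) (i j : nat) : R :=
  if j == i then d i else if j == i.+1 then u i
  else if i == j.+1 then 1 else 0.

Lemma det_tridiagE l d u :
  \det (tridiag l d u) = leading_det (tridiag_entry d u) l.
Proof. by []. Qed.

Section TridiagEntry.
Variables d u : nat -> R.

Lemma tridiag_entry_diag i : tridiag_entry d u i i = d i.
Proof. by rewrite /tridiag_entry eqxx. Qed.

Lemma tridiag_entry_super i : tridiag_entry d u i i.+1 = u i.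
Proof. by rewrite /tridiag_entry eqxx ifN //; lia. Qed.

Lemma tridiag_entry_sub i : tridiag_entry d u i.+1 i = 1.
Proof. by rewrite /tridiag_entry eqxx !ifN //; lia. Qed.

Lemma tridiag_entry_below i j : (j.+1 < i)%N -> tridiag_entry d u i j = 0.
Proof. by move=> ?; rewrite /tridiag_entry !ifN //; lia. Qed.

Lemma tridiag_entry_above i j : (i.+1 < j)%N -> tridiag_entry d u i j = 0.
Proof. by move=> ?; rewrite /tridiag_entry !ifN //; lia. Qed.

Lemma det_tridiag0 : \det (tridiag 0 d u) = 1.
Proof. exact: det_mx00. Qed.

Lemma det_tridiag1 : \det (tridiag 1 d u) = d 0%N.
Proof. by rewrite det_tridiagE leading_det1 tridiag_entry_diag. Qed.

Lemma det_tridiagSS l :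
  \det (tridiag l.+2 d u)
  = d l.+1 * \det (tridiag l.+1 d u) - u l * \det (tridiag l d u).
Proof.
rewrite !det_tridiagE; have sub1 := tridiag_entry_sub.
have below0 := tridiag_entry_below.
case: l => [|l].
  rewrite leading_det2 // leading_det1 leading_det0 !tridiag_entry_diag.
  by rewrite tridiag_entry_super mulr1.
rewrite leading_det_quadridiag // => [|i j /ltnW]; last first.
  exact: tridiag_entry_above.
by rewrite (tridiag_entry_above (ltnSn _)) mul0r addr0 tridiag_entry_diag
           tridiag_entry_super.
Qed.

End TridiagEntry.

Lemma cloneA_SS l :
  cloneA x y l.+2 = x l.+2 * cloneA x y l.+1 - y l.+1 * cloneA x y l.
Proof. exact: det_tridiagSS. Qed.

Lemma cloneB0 m : cloneB x y 0 m = y m.+1.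
Proof. exact: det_tridiag1. Qed.

Lemma cloneB1 m : cloneB x y 1 m = x m.+3 * y m.+1 - x m.+1 * y m.+2.
Proof.
by rewrite /cloneB det_tridiagSS det_tridiag1 det_tridiag0 /= mulr1 addn1 addn2.
Qed.

(** The exceptional entries of the matrix of B sit at index 0, so from this length on the recurrence
    only meets the shifted [x] and [y]. *)
Lemma cloneB_SS k m :
  cloneB x y k.+2 m
  = x (m + k + 4)%N * cloneB x y k.+1 m - y (m + k + 3)%N * cloneB x y k m.
Proof.
rewrite /cloneB det_tridiagSS /=.
by congr (x _ * _ - y _ * _); lia.
Qed.

(** Carries the words of weights [n] and [n.+1] together, which makes the Fibonacci recursion
    structural. *)
Fixpoint fibwords2 (n : nat) : seq fibword * seq fibword :=
  if n is n'.+1 then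
    let: (ws, ws') := fibwords2 n' in
    (ws', map (cons false) ws' ++ map (cons true) ws)
  else ([:: [::]], [:: [:: false]]).

Definition fibwords n := (fibwords2 n).1.

Lemma fibwordsSS n :
  fibwords n.+2
  = map (cons false) (fibwords n.+1) ++ map (cons true) (fibwords n).
Proof. by rewrite /fibwords /=; case: fibwords2. Qed.

Lemma weight_cons a w : weight (a :: w) = (a.+1 + weight w)%N.
Proof. by rewrite /weight big_cons. Qed.

Lemma weight_nil : weight [::] = 0%N.
Proof. by rewrite /weight big_nil. Qed.

Lemma mem_fibwords n w : (w \in fibwords n) = (weight w == n).
Proof.
elim/ltn_ind: n w => -[|[|n]] IH w.
- by case: w => [|a w]; rewrite inE ?weight_nil // weight_cons.
- case: w => [|a w]; rewrite inE ?weight_nil // weight_cons.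
  case: a => //; case: w => [|b w]; rewrite ?weight_nil // weight_cons.
  by apply/esym/negbTE; rewrite add1n addSn.
rewrite fibwordsSS mem_cat.
case: w => [|a w].
  by rewrite weight_nil; apply/negbTE/negP=> /orP[] /mapP[].
have inj b : injective (cons b : fibword -> fibword) by move=> u v [].
rewrite weight_cons; case: a.
  rewrite (mem_map (inj true)) IH // orbC; case: eqP => [->|ne] /=.
    by rewrite !addSn add0n eqxx.
  by rewrite (introF mapP) => [|[]//]; apply/esym/negbTE; lia.
rewrite (mem_map (inj false)) IH // addSn add0n eqSS.
by rewrite [X in _ || X](introF mapP) ?orbF // => -[].
Qed.

Lemma uniq_fibwords n : uniq (fibwords n).
Proof.
elim/ltn_ind: n => -[|[|n]] IH //.
have inj b : injective (cons b : fibword -> fibword) by move=> u v [].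
rewrite fibwordsSS cat_uniq !map_inj_uniq ?IH //= andbT.
by apply/hasPn=> w /mapP[u _ ->]; apply/mapP=> -[].
Qed.

(* [k] letters 1 are put in front of the words of weight [n]. *)
Definition clone_sum k n : R :=
  \sum_(w <- fibwords n)
    (yfdim w)%:R * tau ^+ count id w * clone_schur_rec x y k w.

Lemma clone_sum0 k : clone_sum k 0 = cloneA x y k.
Proof. by rewrite /clone_sum big_seq1 /= expr0 !mul1r. Qed.

Lemma clone_sum1 k : clone_sum k 1 = clone_sum k.+1 0.
Proof. by rewrite /clone_sum !big_seq1. Qed.

(** Split on the first letter: a 1 lengthens the pending run, while a 2 closes it and produces the
    factor [cloneB], the dimension factor [n.+1] and one [tau]. *)
Lemma clone_sumSS k n :
  clone_sum k n.+2
  = clone_sum k.+1 n.+1 + n.+1%:R * tau * cloneB x y k n * clone_sum 0 n.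
Proof.
rewrite /clone_sum fibwordsSS big_cat !big_map /=; congr (_ + _).
rewrite mulr_sumr big_seq [RHS]big_seq; apply: eq_bigr => w.
by rewrite mem_fibwords => /eqP->; rewrite natrM exprD expr1; ring.
Qed.

(* The recurrence shared by [cloneA] and [cloneB] in their length passes to the
   sums. *)
Lemma clone_sum_rec k n :
  clone_sum k.+2 n
  = x (n + k).+2 * clone_sum k.+1 n - y (n + k).+1 * clone_sum k n.
Proof.
elim/ltn_ind: n k => -[|[|n]] IH k.
- by rewrite !clone_sum0 cloneA_SS.
- by rewrite !clone_sum1 !clone_sum0 cloneA_SS.
(* Both halves of the split obey the recurrence with the same coefficients, because moving a letter
   1 into the run preserves [n + k]. *)
rewrite !clone_sumSS IH // cloneB_SS.
have ->: (n.+1 + k.+1 = n.+2 + k)%N by lia.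
have ->: (n + k + 4 = (n.+2 + k).+2)%N by lia.
have ->: (n + k + 3 = (n.+2 + k).+1)%N by lia.
ring.
Qed.

(** Split off two letters and apply [clone_sum_rec] to the run of two 1s. The part [x n.+3 * y n.+1]
    of [cloneB1] is absorbed by [x n.+3 * clone_sum 0 n.+2]; the other part gives the last term. *)
Lemma clone_sum_quadridiag n :
  clone_sum 0 n.+3
  = x n.+3 * clone_sum 0 n.+2
    - (1 - n.+2%:R * tau) * y n.+2 * clone_sum 0 n.+1
    - n.+1%:R * tau * x n.+1 * y n.+2 * clone_sum 0 n.
Proof.
rewrite !clone_sumSS clone_sum_rec !cloneB0 cloneB1 addn0.
ring.
Qed.

Definition quadridiag_entry (i j : nat) : R :=
  let k := i.+1 in
  if j == i then x k
  else if j == i.+1 then (1 - k%:R * tau) * y k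
  else if j == i.+2 then - (k%:R * tau * x k * y k.+1)
  else if i == j.+1 then 1
  else 0.

Lemma det_quadridiagE n : \det (quadridiagE x y tau n) = clone_sum 0 n.
Proof.
have sub1 i : quadridiag_entry i.+1 i = 1.
  by rewrite /quadridiag_entry eqxx !ifN //; lia.
have below0 i j : (j.+1 < i)%N -> quadridiag_entry i j = 0.
  by move=> ?; rewrite /quadridiag_entry !ifN //; lia.
have above0 i j : (i.+2 < j)%N -> quadridiag_entry i j = 0.
  by move=> ?; rewrite /quadridiag_entry !ifN //; lia.
have diag i : quadridiag_entry i i = x i.+1.
  by rewrite /quadridiag_entry eqxx.
have super i : quadridiag_entry i i.+1 = (1 - i.+1%:R * tau) * y i.+1.
  by rewrite /quadridiag_entry eqxx ifN //; lia.
have super2 i : quadridiag_entry i i.+2 = - (i.+1%:R * tau * x i.+1 * y i.+2).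
  by rewrite /quadridiag_entry eqxx !ifN //; lia.
rewrite -[LHS]/(leading_det quadridiag_entry n).
elim/ltn_ind: n => -[|[|[|n]]] IH.
- by rewrite leading_det0 clone_sum0 /cloneA det_tridiag0.
- by rewrite leading_det1 clone_sum1 clone_sum0 /cloneA det_tridiag1 diag.
- rewrite leading_det2 // clone_sumSS clone_sum1 !clone_sum0 cloneB0 /cloneA.
  rewrite det_tridiagSS det_tridiag1 det_tridiag0 !diag super.
  ring.
rewrite leading_det_quadridiag // !IH //; last by lia.
rewrite clone_sum_quadridiag diag super super2.
ring.
Qed.

End CloneSchurSums.

(** * Shapes, weights and two-cycles of involutions *)

Section InvolutionShape.

(** For an involution [f], every cycle is recorded at its largest element, from the top position
    downwards. *)
Fixpoint involution_word (f : nat -> nat) (k : nat) : fibword :=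
  if k is k'.+1 then
    if (f k' <= k')%N then (f k' < k')%N :: involution_word f k'
    else involution_word f k'
  else [::].

Lemma eq_involution_word f g k :
  (forall i, (i < k)%N -> f i = g i) -> involution_word f k = involution_word g k.
Proof.
elim: k => //= k IH fg; rewrite fg // IH // => i ik.
by rewrite fg // ltnW.
Qed.

Lemma count_involution_word f k :
  count id (involution_word f k) = (\sum_(i < k) (f i < i))%N.
Proof.
elim: k => [|k IH]; first by rewrite big_ord0.
rewrite big_ord_recr /= addnC -IH.
by case: (ltngtP (f k) k) => //= ->; rewrite ltnn.
Qed.

Lemma weight_involution_word f k :
  weight (involution_word f k) = (\sum_(i < k) ((f i <= i) + (f i < i)))%N.
Proof.
elim: k => [|k IH]; first by rewrite big_ord0 weight_nil.
rewrite big_ord_recr /= addnC -IH.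
by case: (ltngtP (f k) k) => _; rewrite ?weight_cons.
Qed.

(* The right-to-left matching pairs the largest free position with its image,
   so after position [k] the matched entries are those whose cycle meets
   [k, oo). *)
Lemma yf_shape_rec_involution (s : seq nat) k (M : seq nat) :
  (forall i, (i < size s)%N ->
     (nth 0 s i < size s)%N /\ nth 0%N s (nth 0%N s i) = i) ->
  (k <= size s)%N ->
  (forall i, (i < size s)%N -> (i \in M) = (k <= i)%N || (k <= nth 0 s i)%N) ->
  yf_shape_rec s k M = involution_word (nth 0%N s) k.
Proof.
move=> invol; elim: k M => //= k IH M lt_ks memM.
set a := nth 0%N s k; have [lt_as sa] := invol _ lt_ks.
rewrite -/a in lt_as sa.
have aM: (a \in M) = (k < a)%N by rewrite memM // sa ltnn orbF.
rewrite aM ltnNge; case: (leqP a k) => [le_ak | lt_ka] /=; last first.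
  apply: IH => [|i lt_is]; first exact: ltnW.
  have [_ si] := invol _ lt_is; rewrite memM //.
  case: (eqVneq i k) => [ik | nik]; first by rewrite ik -/a lt_ka leqnn orbT (ltnW lt_ka).
  case: (eqVneq (nth 0%N s i) k) => [sik | nsik]; last by lia.
  by move: si; rewrite sik -/a; lia.
(* Entries above [k] are already matched, and [k] itself stands at position [a <= k], so it is the
   largest free entry. *)
have ->: (\max_(b <- take k.+1 s | b \notin M) b = k)%N.
  apply/eqP; rewrite eqn_leq; apply/andP; split.
    apply/bigmax_leqP_seq => b /mem_take; case/(nthP 0%N) => i lt_is <-.
    have [? ?] := invol _ lt_is; rewrite memM //; lia.
  apply: (@leq_bigmax_seq _ _ _ (fun b => b)).
    apply/(nthP 0%N); exists a; first by rewrite size_takel.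
    by rewrite nth_take.
  by rewrite memM // ltnn /= -/a -leqNgt.
(* In both branches the new list has the elements of [[:: a, k & M]]; for a fixed point [a] and [k]
   coincide. *)
have memM' M' : M' =i [:: a, k & M] ->
    forall i, (i < size s)%N -> (i \in M') = (k <= i)%N || (k <= nth 0 s i)%N.
  move=> M'E i lt_is; rewrite M'E !inE memM //.
  have [_ si] := invol _ lt_is.
  case: (eqVneq i k) => [ik | nik] /=; first by rewrite ik leqnn orbT.
  case: (eqVneq i a) => [-> | nia] /=; first by rewrite sa leqnn orbT.
  case: (eqVneq (nth 0%N s i) k) => [sik | nsik]; last by lia.
  by move: si; rewrite sik -/a; lia.
rewrite ltn_neqAle le_ak andbT eq_sym; case: (eqVneq a k) => [ak|nak] /=;
  congr (_ :: _); apply: IH; try exact: ltnW; apply: memM' => // i.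
by rewrite ak !inE orbA orbb.
Qed.

Variable n : nat.
Implicit Types s : 'S_n.

Lemma nth_one_line s (i : 'I_n) : nth 0%N (one_line s) i = s i.
Proof.
by rewrite (nth_map i) ?size_enum_ord // nth_ord_enum.
Qed.

Lemma involutionP s : reflect (involutive s) (s \in involutions n).
Proof.
rewrite inE; apply: (iffP eqP) => [ss i | ss].
  by rewrite -permM ss perm1.
by apply/permP=> i; rewrite permM ss perm1.
Qed.

Lemma yf_shape_involution s (f : nat -> nat) :
    s \in involutions n -> (forall i : 'I_n, s i = f i :> nat) ->
  yf_shape s = involution_word f n.
Proof.
move=> /involutionP ss sf.
have sz: size (one_line s) = n by rewrite size_map size_enum_ord.
rewrite /yf_shape yf_shape_rec_involution ?sz //.
- by apply: eq_involution_word => i lt_in; rewrite (nth_one_line s (Ordinal lt_in)) sf.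
- move=> i lt_in; rewrite -[i]/(nat_of_ord (Ordinal lt_in)) nth_one_line.
  by rewrite nth_one_line ss; split=> //=; apply: ltn_ord.
- move=> i lt_in; rewrite -[i]/(nat_of_ord (Ordinal lt_in)) nth_one_line.
  by rewrite (leqNgt n) (leqNgt n (s _)) !ltn_ord.
Qed.

Lemma yf_shape_one_line s :
  s \in involutions n -> yf_shape s = involution_word (nth 0%N (one_line s)) n.
Proof. by move=> s_inv; apply: yf_shape_involution => // i; rewrite nth_one_line. Qed.

Lemma porbit_involutive s i : involutive s -> porbit s i = [set i; s i].
Proof.
move=> ss; apply/setP=> j; rewrite !inE; apply/porbitP/idP => [[k ->]|].
  elim: k => [|k IH]; first by rewrite perm1 eqxx.
  by rewrite expgSr permM; case/orP: IH => /eqP->; rewrite ?ss eqxx ?orbT.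
case/orP=> /eqP->; first by exists 0%N; rewrite perm1.
by exists 1%N; rewrite expg1.
Qed.

(** A two-cycle contains exactly one element that [s] decreases, and the letters 2 count these
    elements. *)
Lemma two_cycles_involution s :
  s \in involutions n -> two_cycles s = count id (yf_shape s).
Proof.
move=> s_inv; have /involutionP ss := s_inv.
rewrite (yf_shape_one_line s_inv) count_involution_word.
have -> : (\sum_(i < n) (nth 0 (one_line s) i < i)
           = #|[set i | (s i < i)%N]|)%N.
  rewrite -sum1dep_card [RHS]big_mkcond; apply: eq_bigr => i _.
  by rewrite nth_one_line; case: (_ < _)%N.
rewrite /two_cycles.
have -> : [set C in porbits s | #|C| == 2%N]
          = porbit s @: [set i | (s i < i)%N].
  apply/setP=> C; rewrite inE; apply/andP/imsetP => [[/imsetP[i _ ->]]|[i]].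
    rewrite porbit_involutive // cards2.
    case: (ltngtP (s i) i) => [lt _|lt _|/val_inj->].
    - by exists i; rewrite ?inE ?porbit_involutive.
    - by exists (s i); rewrite ?inE ?porbit_involutive ?ss // setUC.
    - by rewrite eqxx.
  rewrite inE => lt ->; split; first exact: imset_f.
  by rewrite porbit_involutive // cards2 neq_ltn lt orbT.
rewrite card_in_imset // => i j.
rewrite !inE !porbit_involutive // => lti ltj eqij.
have: i \in [set j; s j] by rewrite -eqij set21.
have: j \in [set i; s i] by rewrite eqij set21.
rewrite !inE => /orP[/eqP-> //|/eqP ji] /orP[/eqP //|/eqP ij].
by move: lti ltj; rewrite -ij -ji => /ltn_trans h /h; rewrite ltnn.
Qed.

Lemma weight_yf_shape s : s \in involutions n -> weight (yf_shape s) = n.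
Proof.
move=> s_inv; have /involutionP ss := s_inv.
rewrite (yf_shape_one_line s_inv) weight_involution_word big_split /=.
under eq_bigr => i _ do rewrite nth_one_line.
under [X in (_ + X)%N]eq_bigr => i _ do rewrite nth_one_line.
(* Reindexing by [s] turns [s i < i] into [i < s i], the complement of [s i <= i], so each position
   contributes 1. *)
rewrite [X in (_ + X)%N](reindex_inj (@perm_inj _ s)) /= -big_split /=.
rewrite -[RHS]card_ord -sum1_card; apply: eq_bigr => i _.
by rewrite ss ltnNge; case: leqP.
Qed.

End InvolutionShape.

(** * Realizing each Fibonacci word as a shape *)

(* Adjacent transpositions for the letters 2, read from the right end of [w]. *)
Fixpoint word_involution (w : fibword) (i : nat) : nat :=
  match w with
  | [::] => i
  | false :: v => word_involution v i
  | true :: v => if i == weight v then i.+1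
                 else if i == (weight v).+1 then i.-1
                 else word_involution v i
  end.

Lemma word_involution_ge w i : (weight w <= i)%N -> word_involution w i = i.
Proof.
elim: w => [|[] v IH] //=; rewrite weight_cons => le_wi; last by apply: IH; lia.
by rewrite !ifN ?IH //; lia.
Qed.

Lemma word_involution_lt w i :
  (i < weight w)%N -> (word_involution w i < weight w)%N.
Proof.
elim: w => [|[] v IH] //=.
  rewrite weight_cons; case: eqP => [->|?]; first by lia.
  case: eqP => [->|? lt_iw]; first by lia.
  by have := IH; lia.
rewrite weight_cons add1n ltnS leq_eqVlt => /predU1P[->|/IH]; last by lia.
by rewrite word_involution_ge.
Qed.

Lemma word_involutionK w : involutive (word_involution w).
Proof.
elim: w => [|[] v IH] //= i.
case: (eqVneq i (weight v)) => [->|ni]; first by rewrite eqxx ifN //; lia.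
case: (eqVneq i (weight v).+1) => [->|ni1]; first by rewrite eqxx.
case: (ltnP i (weight v)) => [/word_involution_lt lt|ge].
  by rewrite !ifN ?IH //; lia.
by rewrite word_involution_ge // !ifN ?word_involution_ge //; lia.
Qed.

Lemma involution_word_involution w :
  involution_word (word_involution w) (weight w) = w.
Proof.
elim: w => [|[] v IH]; rewrite ?weight_nil // weight_cons /=.
  rewrite add0n !eqxx (gtn_eqF (ltnSn _)) /= leqnSn ltnn ltnSn.
  congr (_ :: _); rewrite -[RHS]IH; apply: eq_involution_word => i lt_iv.
  by rewrite !ifN //; lia.
by rewrite add0n word_involution_ge // leqnn ltnn IH.
Qed.

(** Guarantees that the number of involutions of a given shape, a denominator in [nu], is
    nonzero. *)
Lemma exists_yf_shape n w :
  weight w = n -> exists2 s : 'S_n, s \in involutions n & yf_shape s = w.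
Proof.
move=> <-; set f := word_involution w.
pose g (i : 'I_(weight w)) := Ordinal (word_involution_lt (ltn_ord i)).
have gK : involutive g by move=> i; apply: val_inj; apply: word_involutionK.
exists (perm (inv_inj gK)).
  by apply/involutionP=> i; rewrite !permE gK.
rewrite (@yf_shape_involution _ _ f) ?involution_word_involution //.
  by apply/involutionP=> i; rewrite !permE gK.
by move=> i; rewrite permE.
Qed.

Theorem proposition17p1 (R : realFieldType) (x y : nat -> R) (n : nat) (tau : R) :
  fibonacci_positive x y ->
  (1 <= n)%N ->
  expectation (nu x y (n := n)) (fun s => tau ^+ two_cycles s)
  = (\prod_(1 <= i < n.+1) x i)^-1 * \det (quadridiagE x y tau n).
Proof.
move=> _ _; rewrite det_quadridiagE /clone_sum mulr_sumr /expectation.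
pose F w : R := (yfdim w)%:R * clone_harmonic x y w * tau ^+ count id w.
pose N w := #|[set t in involutions n | yf_shape t == w]|.
(* The inner sum has the single term [w = yf_shape s]; it is introduced so that the two sums can be
   exchanged. *)
transitivity (\sum_(s in involutions n)
    \sum_(w <- fibwords n | yf_shape s == w) F w / (N w)%:R).
  rewrite [RHS]big_mkcond; apply: eq_bigr => s _; rewrite /nu.
  case: ifPn => [s_inv|]; last by rewrite mul0r.
  rewrite big_mkcond (bigD1_seq (yf_shape s)) ?uniq_fibwords //=;
    last by rewrite mem_fibwords weight_yf_shape.
  rewrite eqxx big1 ?addr0 => [|w]; last by rewrite eq_sym => /negPf->.
  by rewrite two_cycles_involution // /F /N mulrAC.
rewrite (exchange_big_dep xpredT) //= big_seq [RHS]big_seq; apply: eq_bigr => w.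
rewrite mem_fibwords => /eqP wn.
rewrite sumr_const; have [s s_inv ws] := exists_yf_shape wn.
have Nw: #|[pred t in involutions n | yf_shape t == w]| = N w.
  by apply: eq_card => t; rewrite !inE.
(* The summand no longer depends on the involution and occurs [N w] times, which cancels the uniform
   probability. *)
rewrite Nw -[F w / _ *+ _]mulr_natr divfK; last first.
  rewrite Num.Theory.pnatr_eq0 -lt0n; apply/card_gt0P.
  by exists s; rewrite inE s_inv ws eqxx.
by rewrite /F /clone_harmonic wn /clone_schur; ring.
Qed.
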